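(* Let $\eta\in\mathbb C\setminus\{0\}$ and let $V_{\lambda_1}(\delta_1)$, $V_{\lambda_2}(\delta_2)$ be evaluation representations modelled on arbitrary (finite- or infinite-dimensional) highest weight representations of $\mathfrak{sl}_2$. The expression $$Q_{12}^{-1}=\frac{\Gamma\bigl((\delta_1-\delta_2)/\eta+H\otimes1-1\otimes H\bigr)}{\Gamma\bigl((\delta_1-\delta_2)/\eta+H\otimes1-\lambda_2\bigr)}\cdot\frac{\Gamma\bigl((\delta_1-\delta_2)/\eta-\lambda_1-\lambda_2\bigr)}{\Gamma\bigl((\delta_1-\delta_2)/\eta-\lambda_1-1\otimes H\bigr)}$$ specializes on all weight vectors $|\ell,k\rangle$ of $V_{\lambda_1}(\delta_1)\otimes V_{\lambda_2}(\delta_2)$ to $Q_{12}^{-1}|\ell,k\rangle=q_{\ell k}|\ell,k\rangle$, where $$q_{\ell k}=\prod_{j=0}^{k-1}\frac{\delta_1-\delta_2+\eta(\lambda_1-\lambda_2-\ell+j)}{\delta_1-\delta_2+\eta(-\lambda_1-\lambda_2+j)}$$ is a solution of the recursion relations $q_{\ell k}/q_{\ell-1,k}=g(-\ell)/g(k-\ell)$, $q_{\ell,k+1}/q_{\ell k}=g(k-\ell)/g(-2\lambda_1+k)$ with $g(x)=\delta_1-\delta_2+\eta(\lambda_1-\lambda_2+x)$.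
   Context: For $\lambda\in\mathbb C$, $V_\lambda$ is the highest weight $\mathfrak{sl}_2$-representation with weight basis $|k\rangle$, $k\in K_\lambda$, $H|k\rangle=(\lambda-k)|k\rangle$, where $K_\lambda=\{0,\dots,2\lambda\}$ if $2\lambda\in\mathbb N_0$ and $K_\lambda=\mathbb N_0$ otherwise. $V_\lambda(\delta)$ is the evaluation representation of the Yangian $Y(\mathfrak{sl}_2)$ with parameter $\delta\in\mathbb C$ on the space $V_\lambda$. $|\ell,k\rangle=|\ell\rangle\otimes|k\rangle$ for $(\ell,k)\in K_{\lambda_1}\times K_{\lambda_2}$, so $H\otimes 1|\ell,k\rangle=(\lambda_1-\ell)|\ell,k\rangle$ and $1\otimes H|\ell,k\rangle=(\lambda_2-k)|\ell,k\rangle$. Functions of $H\otimes1$, $1\otimes H$ are applied to eigenvalues on the basis vectors $|\ell,k\rangle$. On each $|\ell,k\rangle$ the two quotients of Gamma functions have the form $\Gamma(x+k)/\Gamma(x)$ and $\Gamma(y)/\Gamma(y+k)$ with $k\in\mathbb N_0$; they are understood as quotients, i.e. as the rational functions $\prod_{j=0}^{k-1}(x+j)$ and $\prod_{j=0}^{k-1}(y+j)^{-1}$ of $\delta_1-\delta_2$, also where individual Gamma functions have poles. *)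

(* Defs.v *)
From HB Require Import structures.
From mathcomp Require Import all_boot all_order all_algebra finmap.
From mathcomp Require Import complex.
From mathcomp Require Import all_classical all_reals all_analysis.
From mathcomp Require monalg.
(* The notations of monalg clash with those of MathComp-Analysis. *)
Import -(notations) monalg.

Set Implicit Arguments.
Unset Strict Implicit.
Unset Printing Implicit Defensive.

Import Order.TTheory GRing.Theory Num.Theory.
Import numFieldNormedType.Exports.

Local Open Scope classical_set_scope.
Local Open Scope ring_scope.

(* The usual topology of the complex plane, as a normed space over itself. *)
HB.instance Definition _ (R : realType) :=
  NormedModule.copy R[i] (R[i] : numFieldType)^o.

Section ComplexGamma.
Context {R : realType}.
Local Notation C := R[i].

Definition cexp (z : C) : C :=
  ((expR (complex.Re z) * cos (complex.Im z))
    +i* (expR (complex.Re z) * sin (complex.Im z)))%C.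

(* n ^ z, meaningful for n > 0 *)
Definition nat_cpow (n : nat) (z : C) : C := cexp (z * (ln (n%:R : R))%:C)%C.

(* Euler's limit formula.  The value at the poles 0, -1, -2, ... is
   meaningless. *)
Definition Gamma (z : C) : C :=
  limn (fun n => n`!%:R * nat_cpow n z / \prod_(j < n.+1) (z + j%:R) : C).

(* The quotient Gamma(x) / Gamma(y), read as the value at w = 0 of the
   meromorphic function w |-> Gamma(x + w) / Gamma(y + w).  It is therefore
   also meaningful when Gamma has a pole at x and at y, and meaningless only
   where the quotient itself has a pole. *)
Definition Gamma_quot (x y : C) : C :=
  lim ((Gamma (x + w) / Gamma (y + w) : C) @[w --> (0 : C)^']).

End ComplexGamma.

Section FreeSpaces.
Context {R : realType}.
Local Notation C := R[i].

(* [malg K C] is the complex vector space with basis K. *)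
Definition basis_vec (K : choiceType) (i : K) : malg K C := mkmalgU i 1.

Definition lin_ext (K : choiceType) (W : lmodType C) (e : K -> W)
    (v : malg K C) : W :=
  \sum_(i <- msupp v) mcoeff i v *: e i.

Lemma lin_ext_basis (K : choiceType) (W : lmodType C) (e : K -> W) (i : K) :
  lin_ext e (basis_vec i) = e i.
Proof.
by rewrite /lin_ext msuppU oner_eq0 big_seq_fset1 mcoeffUU scale1r.
Qed.

Lemma lin_ext_linear (K : choiceType) (W : lmodType C) (e : K -> W) :
  linear (lin_ext e).
Proof.
move=> a u v; pose D := (msupp u `|` msupp v `|` msupp (a *: u + v))%fset.
have ext (w : malg K C) : (msupp w `<=` D)%fset ->
    lin_ext e w = \sum_(i <- D) mcoeff i w *: e i.
  move=> wD; apply: big_fset_incl => // i _ /mcoeff_outdom ->.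
  by rewrite scale0r.
rewrite !ext; first last.
- exact: fsubsetUr.
- by rewrite /D -fsetUA fsubsetUl.
- by rewrite /D (fsetUC (msupp u)) -fsetUA fsubsetUl.
rewrite scaler_sumr -big_split/=; apply: eq_bigr => i _.
by rewrite mcoeffD mcoeffZ scalerDl scalerA.
Qed.

Lemma lin_extZ (K : choiceType) (W : lmodType C) (e : K -> W) (a : C)
    (v : malg K C) : lin_ext e (a *: v) = a *: lin_ext e v.
Proof.
have := lin_ext_linear e a v 0.
by rewrite addr0 => ->; rewrite {2}/lin_ext msupp0 big_seq_fset0 addr0.
Qed.

(* The tensor product of the spaces with bases K and L is the space with
   basis K * L. *)
Definition tens (K L : choiceType) (v : malg K C) (w : malg L C) :
    malg (K * L)%type C :=
  lin_ext (fun i => lin_ext (fun j => basis_vec (i, j)) w) v.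

Definition tens_op (K L : choiceType) (A : malg K C -> malg K C)
    (B : malg L C -> malg L C) : malg (K * L)%type C -> malg (K * L)%type C :=
  lin_ext (fun ij => tens (A (basis_vec ij.1)) (B (basis_vec ij.2))).

(* f(A, B) for operators A, B that are diagonal in the basis K: the
   eigenvalue of A on the basis vector i is the i-th coefficient of A i. *)
Definition op_fun (K : choiceType) (f : C -> C -> C)
    (A B : malg K C -> malg K C) : malg K C -> malg K C :=
  lin_ext (fun i => f (mcoeff i (A (basis_vec i))) (mcoeff i (B (basis_vec i)))
                      *: basis_vec i).

Lemma op_fun_basis (K : choiceType) (f : C -> C -> C)
    (A B : malg K C -> malg K C) (i : K) (a b : C) :
  A (basis_vec i) = a *: basis_vec i -> B (basis_vec i) = b *: basis_vec i ->
  op_fun f A B (basis_vec i) = f a b *: basis_vec i.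
Proof.
move=> Ai Bi; rewrite /op_fun lin_ext_basis Ai Bi.
by rewrite !mcoeffZ !mcoeffUU !mulr1.
Qed.

End FreeSpaces.

Section HighestWeight.
Context {R : realType}.
Local Notation C := R[i].

(* The index set K_lambda: {0, ..., 2 lambda} if 2 lambda is a natural number
   (the bounding condition then holds for n = 2 lambda only), and all of nat
   otherwise (the condition is then void). *)
Definition wt_index (lambda : C) : set nat :=
  [set k | forall n : nat, 2 * lambda = n%:R -> (k <= n)%N].

(* The space of V_lambda, which is also the space of the evaluation
   representation V_lambda(delta) for every delta; of the action, only that of
   H is used. *)
Local Notation hw_space lambda := (malg (wt_index lambda) C).

Definition Hop (lambda : C) : hw_space lambda -> hw_space lambda :=
  lin_ext (fun k => (lambda - (\val k)%:R) *: basis_vec k).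

Local Notation tens_space lambda1 lambda2 :=
  (malg (wt_index lambda1 * wt_index lambda2)%type C).

Definition ket (lambda1 lambda2 : C) (l : wt_index lambda1)
    (k : wt_index lambda2) : tens_space lambda1 lambda2 :=
  tens (basis_vec l) (basis_vec k).

(* H (x) 1 and 1 (x) H *)
Definition Hleft (lambda1 lambda2 : C) :
    tens_space lambda1 lambda2 -> tens_space lambda1 lambda2 :=
  tens_op (@Hop lambda1) id.

Definition Hright (lambda1 lambda2 : C) :
    tens_space lambda1 lambda2 -> tens_space lambda1 lambda2 :=
  tens_op id (@Hop lambda2).

Lemma ketE (lambda1 lambda2 : C) (l : wt_index lambda1)
    (k : wt_index lambda2) : ket l k = basis_vec (l, k).
Proof. by rewrite /ket /tens !lin_ext_basis. Qed.

Lemma Hleft_ket (lambda1 lambda2 : C) (l : wt_index lambda1)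
    (k : wt_index lambda2) :
  Hleft (ket l k) = (lambda1 - (\val l)%:R) *: ket l k.
Proof.
by rewrite ketE /Hleft /tens_op lin_ext_basis/= /Hop /tens !lin_ext_basis
  lin_extZ !lin_ext_basis.
Qed.

Lemma Hright_ket (lambda1 lambda2 : C) (l : wt_index lambda1)
    (k : wt_index lambda2) :
  Hright (ket l k) = (lambda2 - (\val k)%:R) *: ket l k.
Proof.
by rewrite ketE /Hright /tens_op lin_ext_basis/= /Hop /tens !lin_ext_basis
  lin_extZ !lin_ext_basis.
Qed.

End HighestWeight.

Section Intertwiner.
Context {R : realType}.
Local Notation C := R[i].
Variables (eta lambda1 lambda2 delta1 delta2 : C).

(* The expression for the inverse of Q_12, as a function of the eigenvalues h1
   of H (x) 1 and h2 of 1 (x) H *)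
Definition Qinv_expr (h1 h2 : C) : C :=
  let u := (delta1 - delta2) / eta in
  Gamma_quot (u + h1 - h2) (u + h1 - lambda2)
  * Gamma_quot (u - lambda1 - lambda2) (u - lambda1 - h2).

Definition Qinv :
    malg (wt_index lambda1 * wt_index lambda2)%type C ->
    malg (wt_index lambda1 * wt_index lambda2)%type C :=
  op_fun Qinv_expr (@Hleft R lambda1 lambda2) (@Hright R lambda1 lambda2).

Definition g (x : C) : C := delta1 - delta2 + eta * (lambda1 - lambda2 + x).

Definition q_denom (j : nat) : C :=
  delta1 - delta2 + eta * (- lambda1 - lambda2 + j%:R).

Definition q (l k : nat) : C :=
  \prod_(j < k)
    ((delta1 - delta2 + eta * (lambda1 - lambda2 - l%:R + j%:R)) / q_denom j).

(* The denominators of q l k do not vanish. *)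
Definition q_defined (k : nat) : Prop :=
  forall j : nat, (j < k)%N -> q_denom j != 0.

End Intertwiner.

(* Main.v *)
(** Euler's sequence for Gamma(z) is, up to its term of index 1, the product of
    the factors (1 + 1/n)^z / (1 + z/(n+1)), each of which is 1 + O(1/(n(n+1))).
    When z is not a pole the sequence therefore converges, and to a nonzero
    limit, since the inverse factors satisfy the same bound.  Passing to the
    limit gives Gamma(z+1) = z Gamma(z).  A Gamma quotient whose arguments
    differ by k is then, in a punctured neighbourhood of w = 0, a polynomial in
    w or the inverse of one, and its limit at w = 0 is the value of that
    polynomial (or its inverse), also when the individual Gamma functions have
    poles there.  The recursions are telescoping products. *)

Require Import Defs.
From HB Require Import structures.
From mathcomp Require Import all_boot all_order all_algebra finmap.
From mathcomp Require Import complex.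
From mathcomp Require Import all_classical all_reals all_analysis.
From mathcomp Require monalg.
From mathcomp Require Import ring lra.
Import -(notations) monalg.
Import Order.TTheory GRing.Theory Num.Theory.
Import numFieldNormedType.Exports.
Local Open Scope classical_set_scope.
Local Open Scope ring_scope.

(** * Elementary real estimates for exp, sin, cos and ln *)

Section RealEstimates.
Context {R : realType}.
Implicit Types x t : R.

(** This rests on [1 + t <= expR t] at [t = x] and at [t = - x]; the latter gives
    [(1 - x) * expR x <= 1]. *)
Lemma norm_expR_sub1_le x : `|expR x - 1| <= `|x| * expR `|x|.
Proof.
have e1 := expR_ge1Dx x; have := expR_ge1Dx (- x).
rewrite expRN => e2; have e0 := expR_gt0 x.
have e3 : (1 - x) * expR x <= 1.
  by rewrite -ler_pdivlMr // div1r.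
have [x0|x0] := leP 0 x.
  by rewrite !ger0_norm; nra.
have : 1 <= expR (- x) by rewrite ltW// expR_gt1; lra.
by rewrite (ltr0_norm x0) ler0_norm; nra.
Qed.

Lemma norm_expR_sub_linear_le x : `|expR x - 1 - x| <= x ^+ 2 * expR `|x|.
Proof.
have e1 := expR_ge1Dx x; have := expR_ge1Dx (- x).
rewrite expRN => e2; have e0 := expR_gt0 x.
have e3 : (1 - x) * expR x <= 1 by rewrite -ler_pdivlMr // div1r.
have [x0|x0] := leP 0 x.
  by rewrite ger0_norm ?(ger0_norm x0) ?expr2; nra.
have : 1 <= expR (- x) by rewrite ltW// expR_gt1; lra.
by rewrite (ltr0_norm x0) ger0_norm ?expr2; nra.
Qed.

(** Mean value theorem between 0 and [x], negative [x] being treated by oddness. Keeping the factor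
    [cos c] makes a quadratic bound on [sin x - x] possible. *)
Lemma sin_mean_value x : exists2 c, `|c| <= `|x| & sin x = cos c * x.
Proof.
have pos (y : R) : 0 <= y -> exists2 c, `|c| <= `|y| & sin y = cos c * y.
  move=> y0; have [|c] := @MVT_segment R sin cos 0 y y0.
    by apply: continuous_subspaceT => z; exact: continuous_sin.
  rewrite in_itv/= => /andP[c0 cy]; rewrite sin0 !subr0 => siny.
  by exists c => //; rewrite !ger0_norm.
have [/pos//|/ltW x0] := leP 0 x.
have [|c cx sinx] := pos (- x); first by rewrite oppr_ge0.
exists c; first by rewrite normrN in cx.
by rewrite sinN mulrN in sinx; apply: oppr_inj.
Qed.

Lemma norm_sin_le x : `|sin x| <= `|x|.
Proof.
have [c _ ->] := sin_mean_value x.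
by rewrite normrM ler_piMl ?cos_max.
Qed.

Lemma cosE_half x : cos x = 1 - 2 * sin (x / 2) ^+ 2.
Proof.
by rewrite {1}(splitr x) -mulr2n cos_mulr2n cos2sin2; ring.
Qed.

Lemma norm_cos_sub1_le x : `|cos x - 1| <= `|x|.
Proof.
rewrite cosE_half addrAC subrr add0r normrN ger0_norm; last first.
  by rewrite mulr_ge0// sqr_ge0.
have := norm_sin_le (x / 2); have := sin_max (x / 2).
rewrite normrM (@ger0_norm _ 2^-1)// -(real_normK (num_real (sin _))).
by have := normr_ge0 (sin (x / 2)); have := normr_ge0 x; rewrite expr2; nra.
Qed.

Lemma norm_cos_sub1_le_sqr x : `|cos x - 1| <= x ^+ 2.
Proof.
rewrite cosE_half addrAC subrr add0r normrN ger0_norm; last first.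
  by rewrite mulr_ge0// sqr_ge0.
have := norm_sin_le (x / 2); rewrite normrM (@ger0_norm _ 2^-1)//.
rewrite -(real_normK (num_real (sin _))) -(real_normK (num_real x)).
by have := normr_ge0 (sin (x / 2)); have := normr_ge0 x; rewrite !expr2; nra.
Qed.

(** Here [sin x - x = (cos c - 1) * x] with [c] between 0 and [x] in modulus, so each factor is at
    most [|x|]. *)
Lemma norm_sin_sub_linear_le x : `|sin x - x| <= x ^+ 2.
Proof.
have [c cx ->] := sin_mean_value x.
rewrite -{2}[x]mul1r -mulrBl normrM -(real_normK (num_real x)) expr2.
by rewrite ler_wpM2r// (le_trans (norm_cos_sub1_le c)).
Qed.

(** The inequality [ln (1 + y) <= y] is applied to the ratio for the upper bound and to its inverse
    [1 - n.+2%:R^-1] for the lower one. *)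
Lemma ln_succ_ratio_bounds (n : nat) :
  n.+2%:R^-1 <= ln (n.+2%:R / n.+1%:R : R) <= n.+1%:R^-1.
Proof.
have a0 : n.+1%:R != 0 :> R by rewrite pnatr_eq0.
have b0 : n.+1%:R + 1 != 0 :> R by rewrite natr1 pnatr_eq0.
have e1 : n.+2%:R / n.+1%:R = 1 + n.+1%:R^-1 :> R.
  by rewrite -[n.+2%:R]natr1; move: n.+1%:R a0 b0 => a a0 b0; field.
have e2 : (n.+2%:R / n.+1%:R)^-1 = 1 - n.+2%:R^-1 :> R.
  rewrite -[n.+2%:R]natr1; move: n.+1%:R a0 b0 => a a0 b0.
  by field; rewrite a0 b0.
have p : 0 < n.+2%:R / n.+1%:R :> R by rewrite divr_gt0.
apply/andP; split.
  rewrite -lerN2 -lnV ?posrE// e2 le_ln1Dx//.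
  by rewrite ltrN2 invf_lt1 ?ltr1n.
by rewrite e1 le_ln1Dx// (@lt_trans _ _ 0)// ?invr_gt0// ltrN10.
Qed.

(** The partial sums collapse to [c * (1 - harmonic n)]. This is the comparison series for Euler's
    product. *)
Lemma is_cvg_series_telescoping_reciprocals (c : R) :
  cvgn (series (fun n => c * (n.+1%:R^-1 - n.+2%:R^-1) : R)).
Proof.
have -> : series (fun n => c * (n.+1%:R^-1 - n.+2%:R^-1) : R) =
          (fun n => c * (1 - harmonic n)).
  apply/funext => n; rewrite seriesEnat/= -big_distrr/=; congr (_ * _).
  by rewrite -[LHS]opprK -sumrN (eq_bigr (fun k => harmonic k.+1 - harmonic k))
    => [|i _]; rewrite ?opprB// telescope_sumr// opprB /harmonic/= invr1.
apply: is_cvgM; first exact: is_cvg_cst.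
apply: is_cvgB; first exact: is_cvg_cst.
by apply: cvgP; exact: cvg_harmonic.
Qed.

End RealEstimates.

(** * Convergence of complex sequences and infinite products *)

Section ComplexSequences.
Context {R : realType}.
Local Notation C := R[i].
Import ComplexField.Normc.

(** The norm of [R[i]] has values in [R[i]]; the estimates are made with the real-valued [normc]. *)
Lemma normcE (z : C) : `|z| = (normc z)%:C%C.
Proof. by []. Qed.

Lemma normc_ge0 (z : C) : 0 <= normc z.
Proof. by case: z => x y; exact: sqrtr_ge0. Qed.

Lemma norm_Re_le_normc (z : C) : `|complex.Re z| <= normc z.
Proof. by rewrite -lecR; exact: normc_ge_Re. Qed.

Lemma norm_Im_le_normc (z : C) : `|complex.Im z| <= normc z.
Proof.
have := norm_Re_le_normc (z * 'i%C).
by rewrite ReiNIm normrN normcM /= expr0n expr1n add0r sqrtr1 mulr1.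
Qed.

Lemma normc_real (x : R) : normc x%:C%C = `|x|.
Proof. by rewrite /= expr0n addr0 sqrtr_sqr. Qed.

Lemma normc_imag (x : R) : normc (0 +i* x)%C = `|x|.
Proof. by rewrite /= expr0n add0r sqrtr_sqr. Qed.

Lemma normc_le_ReIm (z : C) : normc z <= `|complex.Re z| + `|complex.Im z|.
Proof.
have {1}-> : z = (complex.Re z)%:C%C + (0 +i* complex.Im z)%C.
  by case: z => x y; apply/eqP; rewrite eq_complex/= addr0 add0r !eqxx.
by rewrite -normc_real -(normc_imag (complex.Im z)); exact: le_normcD.
Qed.

(** A positive element of [R[i]] has zero imaginary part, so only real parts are compared. *)
Lemma normc_lt_norm (z e : C) : 0 < e ->
  (`|z| < e) = (normc z < complex.Re e).
Proof.
by move=> e0; rewrite normcE ltcE/= (ger0_Im (ltW e0)) eqxx.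
Qed.

Lemma cvg_complex (u : nat -> C) (a b : R) :
  (fun n => complex.Re (u n)) @ \oo --> a ->
  (fun n => complex.Im (u n)) @ \oo --> b -> u @ \oo --> (a +i* b)%C.
Proof.
move=> /cvgrPdist_lt ua /cvgrPdist_lt ub; apply/cvgrPdist_lt => e e0.
have e2 : 0 < complex.Re e / 2 by case: e e0 => x y; rewrite ltcE/= => /andP[_]; lra.
near=> n; rewrite normc_lt_norm//.
have un : `|a - complex.Re (u n)| < complex.Re e / 2 by near: n; exact: ua.
have vn : `|b - complex.Im (u n)| < complex.Re e / 2 by near: n; exact: ub.
rewrite (le_lt_trans (normc_le_ReIm _))// (splitr (complex.Re e)).
by case: (u n) un vn => x y /= un vn; rewrite ltrD.
Unshelve. all: by end_near. Qed.

(** The telescoping series of the increments converges absolutely. *)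
Lemma cvg_seq_of_summable_increments (u : nat -> R) (b : nat -> R) :
  (forall n, `|u n.+1 - u n| <= b n) -> cvgn (series b) -> cvgn u.
Proof.
move=> ub cb.
have : cvgn (series (telescope u)).
  apply: normed_cvg; apply: (series_le_cvg _ _ ub cb) => n//.
  exact: le_trans (ub n).
move=> cvt; have -> : u = (fun n => u 0%N + series (telescope u) n).
  by apply/funext => n; rewrite [LHS](@eq_sum_telescope _ u).
by apply: is_cvgD => //; exact: is_cvg_cst.
Qed.

Lemma is_cvg_bounded (u : nat -> C) : cvgn u ->
  exists2 M : R, 0 <= M & forall n, normc (u n) <= M.
Proof.
move=> /cvg_seq_bounded [[x y] [yr uM]].
(* Boundedness provides a bound at every number strictly above [x +i* y], hence the [+ 1]. *)
have e : (x +i* y < (x +i* y) + 1 :> C)%C by rewrite ltrDl.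
exists (`|x + 1|) => // n.
have : (`|u n| <= (x +i* y) + 1 :> C)%C := uM _ e n I.
by rewrite normcE lecE/= => /andP[_ h]; rewrite (le_trans h)// ler_norm.
Qed.

(** The inverses converge to [l^-1], so they are bounded; a vanishing term has inverse 0 by
    convention, and the bound holds for every [n]. *)
Lemma cvg_inv_bounded (u : nat -> C) (l : C) : l != 0 -> u @ \oo --> l ->
  exists2 M : R, 0 <= M & forall n, normc (u n)^-1 <= M.
Proof.
move=> l0 ul; apply: is_cvg_bounded; apply: cvgP.
exact: cvgV l0 ul.
Qed.

Lemma complex_cvg_of_summable_increments (u : nat -> C) (b : nat -> R) :
  (forall n, normc (u n.+1 - u n) <= b n) -> cvgn (series b) -> cvgn u.
Proof.
move=> ub cb.
have cRe : cvgn (fun n => complex.Re (u n)).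
  apply: cvg_seq_of_summable_increments cb => n; apply: le_trans (ub n).
  by have := norm_Re_le_normc (u n.+1 - u n); case: (u n.+1) (u n) => ? ? [].
have cIm : cvgn (fun n => complex.Im (u n)).
  apply: cvg_seq_of_summable_increments cb => n; apply: le_trans (ub n).
  by have := norm_Im_le_normc (u n.+1 - u n); case: (u n.+1) (u n) => ? ? [].
by apply: cvgP; apply: cvg_complex; [exact: cRe|exact: cIm].
Qed.

(** The partial products [P n] are bounded by [expR B], where [B] bounds the partial sums of [b];
    the increments [P n * (r n - 1)] are then dominated by [expR B * b n]. *)
Lemma is_cvg_prod (r : nat -> C) (b : nat -> R) :
  (forall n, normc (r n - 1) <= b n) -> cvgn (series b) ->
  cvgn (fun n => \prod_(i < n) r i : C).
Proof.
move=> rb cb; have b0 n : 0 <= b n := le_trans (normc_ge0 _) (rb n).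
have [B sB] : exists B, forall n, series b n <= B.
  exists (limn (series b)) => n; apply: nondecreasing_cvgn_le => //.
  by apply/nondecreasing_seqP => m; rewrite seriesSr lerDl.
have P_le n : normc (\prod_(i < n) r i) <= expR (series b n).
  elim: n => [|n IHn].
    by rewrite big_ord0 normc1 seriesEnat/= big_geq// expR0.
  rewrite big_ord_recr/= normcM seriesSr expRD ler_pM ?normc_ge0//.
  have -> : r n = 1 + (r n - 1) by rewrite addrC subrK.
  rewrite (le_trans (le_normcD _ _))// normc1.
  by rewrite (le_trans _ (expR_ge1Dx _))// lerD2l.
apply: (@complex_cvg_of_summable_increments _ (fun n => expR B * b n)) => [n|].
  have -> : \prod_(i < n.+1) r i - \prod_(i < n) r i =
            (\prod_(i < n) r i) * (r n - 1).
    by rewrite big_ord_recr/= mulrBr mulr1.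
  rewrite normcM ler_pM ?normc_ge0// (le_trans (P_le n))//.
  by rewrite ler_expR sB.
exact: (@is_cvg_seriesZ R b (expR B)).
Qed.

(* Both the product and its inverse converge, and the product of the two limits
   is 1. *)
Lemma cvg_prod_neq0 (r : nat -> C) (b : nat -> R) :
  (forall n, r n != 0) -> (forall n, normc (r n - 1) <= b n) ->
  cvgn (series b) ->
  exists2 l : C, l != 0 & (fun n => \prod_(i < n) r i : C) @ \oo --> l.
Proof.
move=> r0 rb cb; have b0 n : 0 <= b n := le_trans (normc_ge0 _) (rb n).
(* Convergence of [r] to 1 bounds the inverses by some [M]; then [(r n)^-1 - 1] is at most [M * b n]
   in modulus, and the product criterion applies to the inverses too. *)
have r1 : r @ \oo --> (1 : C).
  apply/cvgrPdist_lt => e e0; have bcvg := cvg_series_cvg_0 cb.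
  move/cvgrPdist_lt : bcvg => /(_ (complex.Re e)).
  have Re0 : 0 < complex.Re e by case: e e0 => x y; rewrite ltcE/= => /andP[].
  move=> /(_ Re0) be; near=> n; rewrite normc_lt_norm//.
  rewrite -normcN opprB (le_lt_trans (rb n))//.
  have : `|0 - b n| < complex.Re e by near: n.
  by rewrite sub0r normrN ger0_norm.
have [M M0 rM] := cvg_inv_bounded _ _ (oner_neq0 C) r1.
have /cvg_ex[l Pl] := is_cvg_prod _ _ rb cb.
have /cvg_ex[l' Pl'] : cvgn (fun n => \prod_(i < n) (r i)^-1 : C).
  apply: (is_cvg_prod (fun n => (r n)^-1) (fun n => M * b n)) => [n|].
    have -> : (r n)^-1 - 1 = (r n)^-1 * - (r n - 1).
      by rewrite mulrN mulrBr mulVf// mulr1 opprB.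
    by rewrite normcM normcN ler_pM ?normc_ge0.
  exact: (@is_cvg_seriesZ R b M).
exists l; last exact: Pl.
apply/eqP => l0.
have := cvgM Pl Pl'.
rewrite [X in X @ _](_ : _ = cst 1); last first.
  by apply/funext => n /=; rewrite -big_split/= big1// => i _; rewrite mulfV.
have c1 : (cst 1 : nat -> C) @ \oo --> (1 : C) by exact: cvg_cst.
move=> cll.
have e : 1 = l * l' :> C := cvg_unique (@norm_hausdorff _ C) c1 (cll _).
by move: (oner_neq0 C); rewrite e l0 mul0r eqxx.
Unshelve. all: by end_near. Qed.

End ComplexSequences.

(** * Convergence of Euler's sequence and the functional equation of Gamma *)

Section EulerLimit.
Context {R : realType}.
Local Notation C := R[i].
Import ComplexField.Normc.
Implicit Types (z w : C) (n k : nat).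

Lemma cexp0 : cexp 0 = 1 :> C.
Proof. by rewrite /cexp/= expR0 cos0 sin0 mulr1 mulr0. Qed.

Lemma cexpD z w : cexp (z + w) = cexp z * cexp w.
Proof.
case: z w => [x y] [x' y']; rewrite /cexp/= expRD cosD sinD.
by apply/eqP; rewrite eq_complex/=; apply/andP; split; apply/eqP; ring.
Qed.

Lemma cexp_neq0 z : cexp z != 0.
Proof.
apply/eqP => z0; have := cexpD z (- z).
by rewrite subrr cexp0 z0 mul0r => /eqP; rewrite oner_eq0.
Qed.

(** The real and the imaginary part each split into two terms of size at most
    [expR M * normc z ^+ 2], whence the constant 4. *)
Lemma normc_cexp_sub_linear_le (M : R) z : normc z <= M ->
  normc (cexp z - 1 - z) <= 4 * expR M * normc z ^+ 2.
Proof.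
move=> zM; apply: le_trans (normc_le_ReIm _) _.
have := norm_Im_le_normc z; have := norm_Re_le_normc z.
move: (normc z) zM => r rM; case: z => x y /= xr yr.
have e1 : expR `|x| <= expR M by rewrite ler_expR (le_trans xr).
have e2 : 1 + `|x| <= expR M by rewrite (le_trans (expR_ge1Dx _)).
have e3 : expR x <= expR M by rewrite ler_expR (le_trans (ler_norm x)) ?(le_trans xr).
have r0 : 0 <= r := le_trans (normr_ge0 _) xr.
have x2 : x ^+ 2 <= r ^+ 2 by rewrite -(real_normK (num_real x)) lerXn2r ?nnegrE.
have y2 : y ^+ 2 <= r ^+ 2 by rewrite -(real_normK (num_real y)) lerXn2r ?nnegrE.
have E0 := expR_ge0 M.
have hRe : `|expR x * cos y - 1 - x| <= 2 * expR M * r ^+ 2.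
  have -> : expR x * cos y - 1 - x =
      (expR x - 1 - x) * cos y + (1 + x) * (cos y - 1) by ring.
  rewrite (le_trans (ler_normD _ _))// -mulrA mulr_natl mulr2n lerD//.
    rewrite normrM (le_trans (ler_piMr _ (cos_max y)))//.
    by rewrite (le_trans (norm_expR_sub_linear_le x))// mulrC ler_pM// sqr_ge0.
  rewrite normrM ler_pM// ?(le_trans (norm_cos_sub1_le_sqr y))//.
  by rewrite (le_trans (ler_normD _ _))// normr1.
have hIm : `|expR x * sin y - 0 - y| <= 2 * expR M * r ^+ 2.
  have -> : expR x * sin y - 0 - y =
      expR x * (sin y - y) + (expR x - 1) * y by ring.
  rewrite (le_trans (ler_normD _ _))// -mulrA mulr_natl mulr2n lerD//.
    rewrite normrM ler_pM// ?(ger0_norm (expR_ge0 _))//.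
    exact: le_trans (norm_sin_sub_linear_le y) y2.
  rewrite normrM expr2 mulrA ler_pM//.
  rewrite (le_trans (norm_expR_sub1_le x))// mulrC.
  by rewrite ler_pM// expR_ge0.
by rewrite (le_trans (lerD hRe hIm))//; lra.
Qed.

Lemma natr_complex n : n%:R = (n%:R : R)%:C%C :> C.
Proof. by rewrite rmorph_nat. Qed.

Definition Gamma_seq z n : C :=
  n`!%:R * nat_cpow n z / \prod_(j < n.+1) (z + j%:R).

(** The ratio of Euler's terms of index [n.+2] and [n.+1]. The shift keeps [nat_cpow] at positive
    integers, where it is meaningful. *)
Definition Gamma_factor z n : C :=
  cexp (z * (ln (n.+2%:R / n.+1%:R : R))%:C%C) / (1 + z * n.+2%:R^-1).

Lemma nat_cpowS n z :
  nat_cpow n.+2 z =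
  nat_cpow n.+1 z * cexp (z * (ln (n.+2%:R / n.+1%:R : R))%:C%C).
Proof.
rewrite /nat_cpow -cexpD -mulrDr -rmorphD ln_div ?posrE//.
by rewrite addrC subrK.
Qed.

Lemma Gamma_seqS z n : (forall m, z + m%:R != 0) ->
  Gamma_seq z n.+2 = Gamma_seq z n.+1 * Gamma_factor z n.
Proof.
move=> z0; rewrite /Gamma_seq /Gamma_factor nat_cpowS big_ord_recr/=.
have : \prod_(i < n.+2) (z + i%:R) != 0 by apply/prodf_neq0 => i _.
rewrite factS natrM.
move: (\prod_(i < n.+2) _) (nat_cpow _ _) (cexp _) (n.+1)`!%:R => P c e f P0.
have n0 : n.+2%:R != 0 :> C by rewrite pnatr_eq0.
have zn := z0 n.+2.
have -> : 1 + z * n.+2%:R^-1 = (z + n.+2%:R) / n.+2%:R.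
  by rewrite mulrDl mulfV// addrC.
move: n.+2%:R n0 zn => N n0 zn.
by field; rewrite P0 zn n0.
Qed.

Lemma Gamma_seq_prod z n : (forall m, z + m%:R != 0) ->
  Gamma_seq z n.+1 = Gamma_seq z 1 * \prod_(i < n) Gamma_factor z i.
Proof.
move=> z0; elim: n => [|n IHn]; first by rewrite big_ord0 mulr1.
by rewrite big_ord_recr/= Gamma_seqS// IHn mulrA.
Qed.

Lemma one_add_div_neq0 z n : z + n.+1%:R != 0 -> 1 + z * n.+1%:R^-1 != 0.
Proof.
move=> zn; have n0 : n.+1%:R != 0 :> C by rewrite pnatr_eq0.
have -> : 1 + z * n.+1%:R^-1 = (z + n.+1%:R) / n.+1%:R.
  by rewrite mulrDl mulfV// addrC.
by rewrite mulf_neq0// invr_eq0.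
Qed.

(** These are the denominators of [Gamma_factor], up to a shift of index; their limit 1 bounds the
    inverses. *)
Lemma cvg_one_add_div z : (fun n => 1 + z * n.+1%:R^-1 : C) @ \oo --> (1 : C).
Proof.
rewrite -[X in _ --> X]addr0; apply: cvgD; first exact: cvg_cst.
rewrite -[X in _ --> X](mulr0 z); apply: cvgM; first exact: cvg_cst.
have h := @cvg_harmonic R.
have -> : (fun n => n.+1%:R^-1 : C) = (fun n => (harmonic n : R)%:C%C).
  by apply/funext => n; rewrite natr_complex -fmorphV.
by apply: cvg_complex => //; exact: cvg_cst.
Qed.

Lemma Gamma_factor_bound z : (forall m, z + m%:R != 0) ->
  exists c : R, forall n,
    normc (Gamma_factor z n - 1) <= c * (n.+1%:R^-1 - n.+2%:R^-1).
Proof.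
move=> z0; have [M M0 invM] := cvg_inv_bounded _ _ (oner_neq0 C) (cvg_one_add_div z).
set Z : R := normc z; have Z0 : 0 <= Z := normc_ge0 z.
(* [M] bounds the inverse denominators. With [t] the logarithm, [s = 1/(n+2)] and [v = 1/(n+1)], the
   8 is the 4 of the bound on [cexp] times the 2 of [t ^+ 2 <= 2 * (v - s)]; the last [Z] comes from
   [z * (t - s)]. *)
exists (M * (8 * expR Z * Z ^+ 2 + Z)) => n.
have := @ln_succ_ratio_bounds R n; rewrite /Gamma_factor.
move: (ln _) => t /andP[st ts].
set s : R := n.+2%:R^-1 in st ts *; set v : R := n.+1%:R^-1 in ts *.
have vE : s * v = v - s.
  rewrite /s /v -[n.+2%:R]natr1.
  have a0 : n.+1%:R != 0 :> R by rewrite pnatr_eq0.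
  have b0 : n.+1%:R + 1 != 0 :> R by rewrite natr1 pnatr_eq0.
  by move: n.+1%:R a0 b0 => a a0 b0; field; rewrite a0 b0.
have s0 : 0 < s by rewrite invr_gt0.
have v1 : v <= 1 by rewrite invf_le1// ler1n.
(* Indeed [v - s = s * v <= s], as [v <= 1]. *)
have v2s : v <= 2 * s.
  by nra.
have t2 : t ^+ 2 <= 2 * (v - s) by rewrite expr2; nra.
have sE : n.+2%:R^-1 = s%:C%C :> C by rewrite natr_complex -fmorphV.
have d0 := one_add_div_neq0 z n.+1 (z0 _).
have := invM n.+1; rewrite sE in d0 *.
move: d0; set d := 1 + z * s%:C%C => d0 dM.
(* Subtracting [d = 1 + z * s] from the exponential leaves its quadratic remainder and the linear
   mismatch [z * (t - s)], both of order [v - s]. *)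
have -> : cexp (z * t%:C%C) / d - 1 =
    d^-1 * ((cexp (z * t%:C%C) - 1 - z * t%:C%C) + z * (t - s)%:C%C).
  rewrite rmorphB/= -[X in _ - X](mulfV d0) [RHS]mulrC -mulrBl; congr (_ / _).
  by rewrite /d; ring.
rewrite normcM -mulrA ler_pM ?normc_ge0//.
rewrite (le_trans (le_normcD _ _))// mulrDl.
have tZ : normc (z * t%:C%C) = Z * t.
  by rewrite normcM normc_real ger0_norm//; lra.
apply: lerD; last first.
  by rewrite normcM normc_real ler_wpM2l// ger0_norm; lra.
have /normc_cexp_sub_linear_le : normc (z * t%:C%C) <= Z.
  by rewrite tZ ler_piMr//; lra.
move=> /le_trans; apply; rewrite tZ exprMn.
have : 0 <= expR Z * Z ^+ 2 by rewrite mulr_ge0 ?expR_ge0 ?sqr_ge0.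
move: (expR Z) (Z ^+ 2) => E Q EQ.
have -> : 4 * E * (Q * t ^+ 2) = 4 * (E * Q) * t ^+ 2 by ring.
by rewrite -[8 * E * Q]mulrA; nra.
Qed.

Lemma cvg_Gamma_seq z : (forall m, z + m%:R != 0) ->
  exists2 l : C, l != 0 & Gamma_seq z @ \oo --> l.
Proof.
move=> z0; have [c cb] := Gamma_factor_bound z z0.
have f0 n : Gamma_factor z n != 0.
  by rewrite mulf_neq0 ?cexp_neq0// invr_eq0 one_add_div_neq0.
have [l l0 fl] := cvg_prod_neq0 _ _ f0 cb (is_cvg_series_telescoping_reciprocals c).
exists (Gamma_seq z 1 * l).
  rewrite mulf_neq0// mulf_neq0 ?invr_eq0 ?mulf_neq0 ?cexp_neq0//.
  by apply/prodf_neq0 => i _.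
rewrite -(cvg_shiftS (Gamma_seq z)).
under eq_fun do rewrite Gamma_seq_prod//.
by apply: cvgM; first exact: cvg_cst.
Qed.

Lemma cvg_Gamma z : (forall m, z + m%:R != 0) -> Gamma_seq z @ \oo --> Gamma z.
Proof.
move=> /cvg_Gamma_seq[l _ zl].
by rewrite /Gamma -[X in limn X]/(Gamma_seq z) (cvg_lim (@norm_hausdorff _ C) zl).
Qed.

Lemma Gamma_neq0 z : (forall m, z + m%:R != 0) -> Gamma z != 0.
Proof.
move=> z0; have [l l0 zl] := cvg_Gamma_seq z z0.
by rewrite /Gamma -[X in limn X]/(Gamma_seq z) (cvg_lim (@norm_hausdorff _ C) zl).
Qed.

Lemma nat_cpowD1 n z : nat_cpow n.+1 (z + 1) = nat_cpow n.+1 z * n.+1%:R.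
Proof.
rewrite /nat_cpow mulrDl cexpD mul1r; congr (_ * _).
by rewrite /cexp/= cos0 sin0 mulr1 mulr0 lnK ?posrE// natr_complex.
Qed.

(** Euler's terms of index [n.+1] at [z + 1] and at [z] differ by the factor
    [z / (1 + (z + 1) / n.+1%:R)], which tends to [z]. *)
Lemma GammaS z : (forall m, z + m%:R != 0) -> Gamma (z + 1) = z * Gamma z.
Proof.
move=> z0.
have z10 m : z + 1 + m%:R != 0 by rewrite -addrA nat1r.
have e n : Gamma_seq (z + 1) n.+1 =
    z * (1 + (z + 1) * n.+1%:R^-1)^-1 * Gamma_seq z n.+1.
  rewrite /Gamma_seq nat_cpowD1 big_ord_recr/= [in RHS]big_ord_recl/= addr0.
  have -> : \prod_(i < n.+1) (z + (bump 0 i)%:R) =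
            \prod_(i < n.+1) (z + 1 + i%:R).
    by apply: eq_bigr => i _; rewrite -addrA nat1r.
  have : \prod_(i < n.+1) (z + 1 + i%:R) != 0 by apply/prodf_neq0 => i _.
  have zz := z0 0%N; rewrite addr0 in zz.
  have n0 : n.+1%:R != 0 :> C by rewrite pnatr_eq0.
  have -> : 1 + (z + 1) * n.+1%:R^-1 = (z + 1 + n.+1%:R) / n.+1%:R.
    by rewrite [RHS]mulrDl mulfV// addrC.
  move: (\prod_(i < n.+1) _) (nat_cpow _ _) (n.+1)`!%:R (z10 n.+1) => P c f.
  move: n.+1%:R n0 => N n0 zn P0.
  by field; rewrite P0 zn n0 zz.
apply: (cvg_unique (@norm_hausdorff _ C) (cvg_Gamma _ z10)) => /=.
rewrite -(cvg_shiftS (Gamma_seq (z + 1))).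
under eq_fun do rewrite e.
apply: cvgM; last by rewrite (cvg_shiftS (Gamma_seq z)); exact: cvg_Gamma.
rewrite -[X in _ --> X]mulr1; apply: cvgM; first exact: cvg_cst.
rewrite -[X in _ --> X]invr1; apply: cvgV; first exact: oner_neq0.
exact: cvg_one_add_div.
Qed.

Lemma Gamma_addn z k : (forall m, z + m%:R != 0) ->
  Gamma (z + k%:R) = (\prod_(j < k) (z + j%:R)) * Gamma z.
Proof.
move=> z0; elim: k => [|k IHk]; first by rewrite big_ord0 addr0 mul1r.
rewrite big_ord_recr/= -natr1 addrA GammaS ?IHk 1?mulrA 1?(mulrC (z + _))//.
by move=> m; rewrite -addrA -natrD.
Qed.

End EulerLimit.

(** * Gamma quotients whose arguments differ by a natural number *)

Section GammaQuotients.
Context {R : realType}.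
Local Notation C := R[i].
Implicit Types (x y z w : C) (k n : nat).

(* At most one of the points [y + n] is nearer to 0 than 1/2. *)
Lemma near0_dnbhs_addn_neq0 y :
  \forall w \near (0 : C)^', forall n, y + w + n%:R != 0.
Proof.
pose near0 d := d <= 2^-1 /\ forall n, y + n%:R != 0 -> d <= `|y + n%:R|.
have [d d0 [d2 dy]] : exists2 d : C, 0 < d & near0 d.
  have half0 : 0 < 2^-1 :> C by rewrite invr_gt0.
  have [[n /andP[yn0 yn2]]|far] :=
      pselect (exists n, (y + n%:R != 0) && (`|y + n%:R| < 2^-1)).
    (* A point [y + m] still nearer to 0 would give [|m - n| < 1], so [m = n]. *)
    exists `|y + n%:R|; first by rewrite normr_gt0.
    split=> [|m ym0]; first exact: ltW.
    have [->//|mn] := eqVneq m n.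
    have [//|lt] := real_leP (normr_real (y + n%:R)) (normr_real (y + m%:R)).
    have : `|(m%:R - n%:R : C)| < 1.
      have -> : m%:R - n%:R = (y + m%:R) - (y + n%:R) :> C by ring.
      rewrite (le_lt_trans (ler_normB _ _))// [ltRHS](splitr 1) div1r ltrD//.
      by rewrite (lt_trans lt).
    have -> : (m%:R - n%:R : C) = (m%:Z - n%:Z)%:~R by rewrite rmorphB.
    rewrite -intr_norm ltrz1 -[1]add0r ltzD1 normr_le0 subr_eq0 eqz_nat.
    by rewrite (negPf mn).
  exists 2^-1 => //; split=> // n yn0.
  have [//|lt] := real_leP (ger0_real (ltW half0)) (normr_real (y + n%:R)).
  by case: far; exists n; rewrite yn0.
have nd : \forall w \near (0 : C)^', `|w| < d.
  exact: (@dnbhs0_lt C C d d0).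
near=> w => n; apply/eqP => ywn.
have w0 : w != 0 by near: w; exact: nbhs_dnbhs_neq.
have wd : `|w| < d by near: w.
have ynE : y + n%:R = - w by rewrite -[RHS]add0r -ywn; ring.
have := dy n; rewrite ynE oppr_eq0 normrN => /(_ w0).
by move=> /(lt_le_trans wd); rewrite ltxx.
Unshelve. all: by end_near. Qed.

Lemma cvg_add_dnbhs0 x : x + w @[w --> (0 : C)^'] --> x.
Proof.
rewrite -[X in _ --> X]addr0; apply: cvgD; first exact: cvg_cst.
exact: nbhs_dnbhs.
Qed.

Lemma cvg_prod_add_dnbhs0 y k :
  \prod_(j < k) (y + w + j%:R) @[w --> (0 : C)^'] --> \prod_(j < k) (y + j%:R).
Proof.
elim: k => [|k IHk].
  under eq_fun do rewrite big_ord0.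
  by rewrite big_ord0; exact: cvg_cst.
under eq_fun do rewrite big_ord_recr/=.
rewrite big_ord_recr/=; apply: cvgM; first exact: IHk.
by apply: cvgD; [exact: cvg_add_dnbhs0|exact: cvg_cst].
Qed.

Lemma Gamma_quot_add_natl y k :
  Gamma_quot (y + k%:R) y = \prod_(j < k) (y + j%:R).
Proof.
apply: cvg_lim; first exact: norm_hausdorff.
apply: cvg_trans (cvg_prod_add_dnbhs0 y k).
apply: near_eq_cvg.
near=> w.
have yw : forall n, y + w + n%:R != 0 by near: w; exact: near0_dnbhs_addn_neq0.
by rewrite addrAC Gamma_addn// mulfK// Gamma_neq0.
Unshelve. all: by end_near. Qed.

(** The hypothesis says that the rational function which the quotient equals near [w = 0] has no
    pole there, so inversion passes to the limit. *)
Lemma Gamma_quot_add_natr x k : \prod_(j < k) (x + j%:R) != 0 ->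
  Gamma_quot x (x + k%:R) = (\prod_(j < k) (x + j%:R))^-1.
Proof.
move=> P0; apply: cvg_lim; first exact: norm_hausdorff.
apply: cvg_trans (cvgV P0 (cvg_prod_add_dnbhs0 x k)).
apply: near_eq_cvg.
near=> w.
have xw : forall n, x + w + n%:R != 0 by near: w; exact: near0_dnbhs_addn_neq0.
rewrite [x + k%:R + w]addrAC Gamma_addn// invfM mulrCA mulfV ?mulr1//.
exact: Gamma_neq0.
Unshelve. all: by end_near. Qed.

End GammaQuotients.

(** The nonvanishing hypotheses make every division genuine. In the last recursion the denominator
    [g (- (2 * lambda1) + k%:R)] is covered by [q_defined k.+1]. *)
Theorem proposition4p7 (R : realType)
    (eta lambda1 lambda2 delta1 delta2 : R[i]) (eta_neq0 : eta != 0) :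
  let q := q eta lambda1 lambda2 delta1 delta2 in
  let g := g eta lambda1 lambda2 delta1 delta2 in
  let q_defined := q_defined eta lambda1 lambda2 delta1 delta2 in
  [/\ (forall (l : wt_index lambda1) (k : wt_index lambda2),
         q_defined (\val k) ->
         Qinv eta delta1 delta2 (ket l k) = q (\val l) (\val k) *: ket l k),
      (forall l k : nat, wt_index lambda1 l -> wt_index lambda2 k ->
         (0 < l)%N -> q_defined k -> q l.-1 k != 0 -> g (k%:R - l%:R) != 0 ->
         q l k / q l.-1 k = g (- l%:R) / g (k%:R - l%:R))
    & (forall l k : nat, wt_index lambda1 l -> wt_index lambda2 k.+1 ->
         q_defined k.+1 -> q l k != 0 ->
         q l k.+1 / q l k = g (k%:R - l%:R) / g (- (2 * lambda1) + k%:R))].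
Proof.
pose Q := q eta lambda1 lambda2 delta1 delta2.
pose G := g eta lambda1 lambda2 delta1 delta2.
pose D := q_denom eta lambda1 lambda2 delta1 delta2.
(* The numerators of [q] are values of [g] at the consecutive points [j - l]; the denominators do
   not depend on [l]. *)
have QE l k : Q l k =
    (\prod_(j < k) G (j%:R - l%:R)) / \prod_(j < k) D j.
  rewrite /Q /q prodf_div; congr (_ / _); apply: eq_bigr => j _.
  by rewrite /G /g; ring.
move=> q0 g0 qd; rewrite /q0 /g0 -/Q -/G; split.
- move=> l k kd; rewrite ketE; set u := (delta1 - delta2) / eta.
  rewrite /Qinv (@op_fun_basis _ _ _ _ _ (l, k)
    (lambda1 - (\val l)%:R) (lambda2 - (\val k)%:R)); first last.
  + by rewrite -ketE Hright_ket.
  + by rewrite -ketE Hleft_ket.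
  suff -> : Qinv_expr eta lambda1 lambda2 delta1 delta2
      (lambda1 - (\val l)%:R) (lambda2 - (\val k)%:R) = Q (\val l) (\val k) by [].
  rewrite /Qinv_expr -/u.
  (* Up to the factor [eta], which cancels in [q], these are the factors of the second Gamma
     quotient; [q_defined] thus excludes its pole. *)
  have DE j : D j = eta * (u - lambda1 - lambda2 + j%:R).
    by rewrite /D /q_denom /u; field.
  have -> : u + (lambda1 - (\val l)%:R) - (lambda2 - (\val k)%:R) =
      u + (lambda1 - (\val l)%:R) - lambda2 + (\val k)%:R by ring.
  have -> : u - lambda1 - (lambda2 - (\val k)%:R) =
      u - lambda1 - lambda2 + (\val k)%:R by ring.
  rewrite Gamma_quot_add_natl Gamma_quot_add_natr; last first.
    apply/prodf_neq0 => j _; have := kd j (ltn_ord j).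
    by rewrite -/(D j) DE mulf_eq0 (negPf eta_neq0).
  rewrite QE -!prodf_div; apply: eq_bigr => j _.
  rewrite DE invfM mulrA; congr (_ / _).
  by rewrite /G /g /u; field.
- move=> l k _ _ l0 kd; rewrite !QE.
  have P0 : \prod_(j < k) D j != 0.
    by apply/prodf_neq0 => j _; exact: kd.
  rewrite mulf_eq0 invr_eq0 (negPf P0) orbF => N0 gkl.
  (* Both sides are the product of [G] over the points [- l, ..., k - l], with the last factor split
     off on the left and the first on the right. *)
  have tele : (\prod_(j < k) G (j%:R - l%:R)) * G (k%:R - l%:R) =
      G (- l%:R) * \prod_(j < k) G (j%:R - l.-1%:R).
    transitivity (\prod_(j < k.+1) G (j%:R - l%:R)).
      by rewrite big_ord_recr.
    rewrite big_ord_recl/= sub0r; congr (_ * _); apply: eq_bigr => j _.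
    (* Positivity of [l] makes [l.-1] the true predecessor, so that [j + 1 - l = j - l.-1]. *)
    congr G; case: l l0 {N0 gkl} => // l _ /=.
    by rewrite /bump/= -[l.+1%:R]natr1 natrD; ring.
  move: (\prod_(j < k) D j) P0 => P P0.
  move: (\prod_(j < k) G (j%:R - l.-1%:R)) N0 tele => N N0 tele.
  move: (\prod_(j < k) G (j%:R - l%:R)) (G (k%:R - l%:R)) gkl tele => N' g' gkl tele.
  have -> : N' = G (- l%:R) * N / g' by rewrite -tele mulfK.
  by field; rewrite P0 N0 gkl.
- move=> l k _ _ kd qlk.
  have -> : G (- (2 * lambda1) + k%:R) = D k.
    by rewrite /G /g /D /q_denom; ring.
  (* The index [k] is the last one covered by [q_defined k.+1]. *)
  have Dk : D k != 0 := kd k (ltnSn k).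
  move: qlk; rewrite !QE !big_ord_recr/= mulf_eq0 negb_or => /andP[N0].
  rewrite invr_eq0 => P0.
  move: (\prod_(j < k) D j) (\prod_(j < k) G _) (D k) P0 N0 Dk => P N d P0 N0 d0.
  by field; rewrite P0 N0 d0.
Qed.
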